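(* Let $f,g:\mathbb{R}\to\mathbb{R}$ be functions, $x\in\mathbb{R}$ and $\beta\in(0,1]$. Then $$\upsilon_{+}^{\beta}[f g](x)=\upsilon_{+}^{\beta}f(x)\,g(x)+\upsilon_{+}^{\beta}g(x)\,f(x)+[f,g]_{\beta}^{+}(x),$$ $$\upsilon_{-}^{\beta}[f g](x)=\upsilon_{-}^{\beta}f(x)\,g(x)+\upsilon_{-}^{\beta}g(x)\,f(x)-[f,g]_{\beta}^{-}(x).$$
   Context: For $0<\beta\le1$ the forward and backward fractional velocities of order $\beta$ are the limits (with $\epsilon>0$) $\upsilon_{+}^{\beta}f(x)=\lim_{\epsilon\to0}\frac{f(x+\epsilon)-f(x)}{\epsilon^{\beta}}$ and $\upsilon_{-}^{\beta}f(x)=\lim_{\epsilon\to0}\frac{f(x)-f(x-\epsilon)}{\epsilon^{\beta}}$. The fractional co-variations are $[f,g]_{\beta}^{+}(x)=\lim_{\epsilon\to0}\frac{f(x+\epsilon)-f(x)}{\epsilon^{\beta/2}}\cdot\frac{g(x+\epsilon)-g(x)}{\epsilon^{\beta/2}}$ and $[f,g]_{\beta}^{-}(x)=\lim_{\epsilon\to0}\frac{f(x)-f(x-\epsilon)}{\epsilon^{\beta/2}}\cdot\frac{g(x)-g(x-\epsilon)}{\epsilon^{\beta/2}}$, with $\epsilon>0$. Convention: each identity is understood whenever the limits on its right-hand side exist in $[-\infty,\infty]$ and that side is a well-defined expression (no $\infty-\infty$; $0\cdot(\pm\infty)=0$). *)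

(* Defs.v *)
From HB Require Import structures.
From mathcomp Require Import all_boot all_order all_algebra.
From mathcomp Require Import all_classical all_reals all_analysis.
Import Order.TTheory GRing.Theory Num.Theory.
Import numFieldNormedType.Exports.
Set Implicit Arguments.
Unset Strict Implicit.
Unset Printing Implicit Defensive.
Local Open Scope classical_set_scope.
Local Open Scope ring_scope.

(** All limits are taken in the extended reals [\bar R], along [0^'+] (epsilon
    tends to 0 through positive values). [lim] is total: its value is the limit
    only under the matching [cvg] hypothesis, which also allows the limits
    [+oo] and [-oo]. *)

Definition fquot {R : realType} (b : R) (f : R -> R) (x e : R) : R :=
  (f (x + e) - f x) / e `^ b.

Definition bquot {R : realType} (b : R) (f : R -> R) (x e : R) : R :=
  (f x - f (x - e)) / e `^ b.

Definition has_fvel {R : realType} (b : R) (f : R -> R) (x : R) : Prop :=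
  cvg ((fquot b f x e)%:E @[e --> 0^'+]).

Definition fvel {R : realType} (b : R) (f : R -> R) (x : R) : \bar R :=
  lim ((fquot b f x e)%:E @[e --> 0^'+]).

Definition has_bvel {R : realType} (b : R) (f : R -> R) (x : R) : Prop :=
  cvg ((bquot b f x e)%:E @[e --> 0^'+]).

Definition bvel {R : realType} (b : R) (f : R -> R) (x : R) : \bar R :=
  lim ((bquot b f x e)%:E @[e --> 0^'+]).

Definition has_fcovar {R : realType} (b : R) (f g : R -> R) (x : R) : Prop :=
  cvg ((fquot (b / 2) f x e * fquot (b / 2) g x e)%:E @[e --> 0^'+]).

Definition fcovar {R : realType} (b : R) (f g : R -> R) (x : R) : \bar R :=
  lim ((fquot (b / 2) f x e * fquot (b / 2) g x e)%:E @[e --> 0^'+]).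

Definition has_bcovar {R : realType} (b : R) (f g : R -> R) (x : R) : Prop :=
  cvg ((bquot (b / 2) f x e * bquot (b / 2) g x e)%:E @[e --> 0^'+]).

Definition bcovar {R : realType} (b : R) (f g : R -> R) (x : R) : \bar R :=
  lim ((bquot (b / 2) f x e * bquot (b / 2) g x e)%:E @[e --> 0^'+]).

(** The sum [u + v + w] contains no [+oo - oo]. *)
Definition sum3_def {R : realType} (u v w : \bar R) : bool :=
  ((u +? v) && (u + v +? w))%E.

(* Main.v *)
Require Import Defs.
From HB Require Import structures.
From mathcomp Require Import all_boot all_order all_algebra.
From mathcomp Require Import all_classical all_reals all_analysis.
From mathcomp Require Import ring.
Import Order.TTheory GRing.Theory Num.Theory.
Import numFieldNormedType.Exports.
Local Open Scope classical_set_scope.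
Local Open Scope ring_scope.

(** Before passing to the limit, the product rule is the exact identity
    D(fg) = Df g + Dg f + Df Dg for forward increments, with a minus sign on
    Df Dg for backward ones, and e^b = e^(b/2) e^(b/2). Since f x and g x are
    finite, the identity passes to the limit in the extended reals. *)

(** Multiplying by a finite constant preserves limits in the extended reals, even an infinite limit
    times 0, where both sides are 0. Only the two additions can fail, and [sum3_def] guards them. *)
Lemma fine_lincomb_cvg (R : realType) (F : set_system R) (FF : ProperFilter F)
    (h u v w : R -> R) (c d : R) (U V W : \bar R) :
  (\forall e \near F, h e = u e * c + v e * d + w e) ->
  (u e)%:E @[e --> F] --> U -> (v e)%:E @[e --> F] --> V ->
  (w e)%:E @[e --> F] --> W ->
  sum3_def (U * c%:E)%E (V * d%:E)%E W ->
  (h e)%:E @[e --> F] --> (U * c%:E + V * d%:E + W)%E.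
Proof.
move=> hE uU vV wW /andP[UV UVW].
apply: (@cvg_trans _ ((u e)%:E * c%:E + (v e)%:E * d%:E + (w e)%:E @[e --> F])%E).
  apply: near_eq_cvg; near=> e.
  by rewrite -!EFinM -!EFinD; congr EFin; apply/esym; near: e.
by apply: cvgeD => //; apply: cvgeD => //; exact: cvgeZr.
Unshelve. all: by end_near. Qed.

Lemma fquotM (R : realType) (b : R) (f g : R -> R) (x e : R) : 0 < e ->
  fquot b (f \* g) x e = fquot b f x e * g x + fquot b g x e * f x
    + fquot (b / 2) f x e * fquot (b / 2) g x e.
Proof.
(* Halving the exponent makes every denominator a power of [powR e (b / 2)], nonzero for [0 < e]; a
   rational identity remains. *)
move=> e0; rewrite /fquot /= [in e `^ b](splitr b) powRD; last by rewrite (gt_eqF e0) implybT.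
by field; rewrite gt_eqF ?powR_gt0.
Qed.

(** The sign comes from expanding the product at [x - e], where each factor is its value at [x]
    minus its increment. *)
Lemma bquotM (R : realType) (b : R) (f g : R -> R) (x e : R) : 0 < e ->
  bquot b (f \* g) x e = bquot b f x e * g x + bquot b g x e * f x
    - bquot (b / 2) f x e * bquot (b / 2) g x e.
Proof.
move=> e0; rewrite /bquot /= [in e `^ b](splitr b) powRD; last by rewrite (gt_eqF e0) implybT.
by field; rewrite gt_eqF ?powR_gt0.
Qed.

Theorem corollary4 (R : realType) (f g : R -> R) (x b : R)
  (b_gt0 : 0 < b) (b_le1 : b <= 1) :
  (has_fvel b f x -> has_fvel b g x -> has_fcovar b f g x ->
   sum3_def (fvel b f x * (g x)%:E)%E (fvel b g x * (f x)%:E)%E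
            (fcovar b f g x) ->
   has_fvel b (f \* g) x /\
   fvel b (f \* g) x =
     (fvel b f x * (g x)%:E + fvel b g x * (f x)%:E + fcovar b f g x)%E)
  /\
  (has_bvel b f x -> has_bvel b g x -> has_bcovar b f g x ->
   sum3_def (bvel b f x * (g x)%:E)%E (bvel b g x * (f x)%:E)%E
            (- bcovar b f g x)%E ->
   has_bvel b (f \* g) x /\
   bvel b (f \* g) x =
     (bvel b f x * (g x)%:E + bvel b g x * (f x)%:E - bcovar b f g x)%E).
Proof.
split=> fv gv fg sum_def.
  have H : (fquot b (f \* g) x e)%:E @[e --> 0^'+] -->
      (fvel b f x * (g x)%:E + fvel b g x * (f x)%:E + fcovar b f g x)%E.
    (* [cvg] unfolds to convergence to [lim], so these hypotheses already name the velocities and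
       the co-variation as limits. *)
    apply: fine_lincomb_cvg fv gv fg sum_def.
    by near=> e; apply: fquotM; near: e; exact: nbhs_right_gt.
  by split; [apply/cvg_ex; eexists; exact: H | exact: cvg_lim H].
have H : (bquot b (f \* g) x e)%:E @[e --> 0^'+] -->
    (bvel b f x * (g x)%:E + bvel b g x * (f x)%:E - bcovar b f g x)%E.
  (* The third summand is the negated product, whose limit is [- bcovar b f g x], as in
     [sum_def]. *)
  apply: fine_lincomb_cvg fv gv (cvgeN fg) sum_def.
  by near=> e; apply: bquotM; near: e; exact: nbhs_right_gt.
by split; [apply/cvg_ex; eexists; exact: H | exact: cvg_lim H].
Unshelve. all: by end_near. Qed.
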